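(* Let $X$ be a metrizable $\mathbb{Q}$-vector space with a translation invariant metric $\mathrm{d}:X\times X\to[0,\infty)$. Let $V_p,V_i$ be complementary $\mathbb{Q}$-vector subspaces of $X$, and let $\rho_p:X\to V_p$ and $\rho_i:X\to V_i$ be the projections with respect to the decomposition $X=V_p+V_i$. Let $\Gamma$ be a subgroup of $X$ which is a finite dimensional $\mathbb{Z}$-module, let $W\subseteq V_i$ be compact, and define the set $\tilde{Y}=\rho_i^{-1}(W)\cap\Gamma\subseteq X$ and the multi-set $Y=\rho_p(\tilde{Y})\subseteq V_p$. Suppose further that: (i) $Z$ is a subspace of $X$ (possibly different from $V_i$) which is complementary to $V_p$, and $\phi_p:X\to V_p$ is the projection onto $V_p$ with respect to the decomposition $X=V_p+Z$; (ii) the group $\Gamma$ has a decomposition of the form $\Gamma=\Lambda+\Lambda_c$, where $\Lambda$ and $\Lambda_c$ are groups with the properties that $\Lambda\cap\Lambda_c=\{0\}$ and $Z\cap\Gamma=\Lambda$; and (iii) $W$ is the image under $\rho_i$ of a compact fundamental domain for $Z/\Lambda'$, where $\Lambda'\leqslant\Lambda$ is a subgroup with $[\Lambda:\Lambda']=N<\infty$. Then there is a bijection $f$ from $Y$ to a subgroup $\Lambda_c'$ of $V_p$ satisfying $\phi_p(\Lambda_c)\leqslant\Lambda_c'$ and $[\Lambda_c':\phi_p(\Lambda_c)]=N$, with the property that $f$ moves every point of $Y$ by at most a uniformly finite amount.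
   Context: Two $\mathbb{Q}$-vector subspaces $U,V$ of $X$ are complementary if $U\cap V=\{0\}$ and $X=U+V$ (Minkowski sum). ''Subspace'' means $\mathbb{Q}$-vector subspace. Subsets of $X$ carry the topology induced from $X$. ''Finite dimensional $\mathbb{Z}$-module'' means finitely generated abelian group. A fundamental domain for $Z/\Lambda'$ is a subset of $Z$ containing exactly one element of each coset of $\Lambda'$ in $Z$. $Y$ is a multi-set: if the restriction of $\rho_p$ to $\tilde Y$ is not injective, elements of $Y$ are listed with the appropriate multiplicity, i.e. the multiplicity of $y$ is $\#(\rho_p^{-1}(y)\cap\tilde Y)$. Accordingly, a bijection $f$ from $Y$ to $\Lambda_c'$ which moves every point by at most a uniformly finite amount means a bijection $g:\tilde Y\to\Lambda_c'$ for which there is a constant $C<\infty$ with $\mathrm{d}(g(\tilde y),\rho_p(\tilde y))\le C$ for all $\tilde y\in\tilde Y$.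
   Formalization: The formal theorem adds the assumption that N = 1 whenever Λ_c = {0}; without it the claim fails, since the conclusion would require a subgroup of order N > 1 in the torsion-free group V_p. *)

(* Defs.v *)
From HB Require Import structures.
From mathcomp Require Import all_boot all_order all_algebra.
From mathcomp Require Import all_classical all_reals topology.

Set Implicit Arguments.
Unset Strict Implicit.
Unset Printing Implicit Defensive.

Import Order.TTheory GRing.Theory Num.Theory.

Local Open Scope classical_set_scope.
Local Open Scope card_scope.
Local Open Scope ring_scope.

(* No compatibility between the metric and the vector space structure is built
   in: translation invariance is the separate predicate [translation_invariant],
   and continuity of x |-> q *: x is not assumed. *)
#[short(type="metricQmodType")]
HB.structure Definition MetricQmodule (R : numDomainType) :=
  {X of Metric R X & GRing.Lmodule rat X}.

Definition translation_invariant (R : numDomainType) (X : metricQmodType R) :=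
  forall x y z : X, mdist (x + z) (y + z) = mdist x y.

Definition minkowski_sum (X : zmodType) (A B : set X) : set X :=
  [set x + y | x in A & y in B].

Definition is_subspace (X : lmodType rat) (U : set X) :=
  GRing.submod_closed [in U].

Definition is_subgroup (X : zmodType) (G : set X) := GRing.zmod_closed [in G].

Definition complementary (X : lmodType rat) (U V : set X) :=
  U `&` V = [set 0] /\ [set: X] = minkowski_sum U V.

Definition is_projection (X : lmodType rat) (U V : set X) (rho : X -> X) :=
  forall x, U (rho x) /\ V (x - rho x).

Definition finitely_generated (X : zmodType) (G : set X) :=
  exists (m : nat) (s : m.-tuple X), G = [set x | inIntSpan s x].

Definition cosets (X : zmodType) (G H : set X) : set (set X) :=
  [set [set x + h | h in H] | x in G].

Definition has_index (X : zmodType) (G H : set X) (N : nat) :=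
  cosets G H #= `I_N.

Definition fundamental_domain (X : zmodType) (Z H F : set X) :=
  F `<=` Z /\ forall C, cosets Z H C -> exists! x, (F `&` C) x.

(* Main.v *)
(** Write L for the image of Lambda_c under phi_p. As rho_i is injective on Z, a
    point y of Gamma lies in Ytilde iff its Z-component y - phi_p y lies in F.
    For y = l + c this component is l + (c - phi_p c), so for each c in Lambda_c
    every coset of Lambda' in Lambda contains exactly one admissible l: Ytilde
    is in bijection with Lambda_c times Lambda / Lambda'. Moreover rho_p y
    differs from phi_p c by z - rho_i z, where z in F is the Z-component of y,
    and this is bounded by compactness. The group L = phi_p(Gamma) is a finitely
    generated subgroup of a rational vector space, so it contains a primitive
    element e; the multiples k e / N (k < N) represent the cosets of L in
    L + Z (e / N), and the coset of l numbered k is sent to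
    phi_p c + k e / N. *)
From HB Require Import structures.
Require Import Defs.
From mathcomp Require Import all_boot all_order all_algebra.
From mathcomp Require Import all_classical all_reals topology.

Import Order.TTheory GRing.Theory Num.Theory.
Local Open Scope classical_set_scope.
Local Open Scope ring_scope.

(** * Closure properties of subgroups and subspaces *)

Lemma subrACA {X : zmodType} (x y z t : X) : x - y - (z - t) = x - z - (y - t).
Proof. by rewrite !opprB [t - z]addrC addrACA [- y + t]addrC. Qed.

Lemma subgroup0 {X : zmodType} {G : set X} : is_subgroup G -> G 0.
Proof. by case=> /set_mem. Qed.

Lemma subgroupB {X : zmodType} {G : set X} : is_subgroup G ->
  forall x y, G x -> G y -> G (x - y).
Proof. by case=> _ GB x y Gx Gy; apply/set_mem/GB; exact/mem_set. Qed.

Lemma subgroupN {X : zmodType} {G : set X} : is_subgroup G ->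
  forall x, G x -> G (- x).
Proof.
by move=> gG x Gx; rewrite -sub0r; apply: subgroupB => //; exact: subgroup0.
Qed.

Lemma subgroupD {X : zmodType} {G : set X} : is_subgroup G ->
  forall x y, G x -> G y -> G (x + y).
Proof.
move=> gG x y Gx Gy; rewrite -(opprK y).
by apply: subgroupB => //; exact: subgroupN.
Qed.

Lemma subgroupMn {X : zmodType} {G : set X} : is_subgroup G ->
  forall x n, G x -> G (x *+ n).
Proof.
move=> gG x n Gx; elim: n => [|n IHn]; first by rewrite mulr0n; exact: subgroup0.
by rewrite mulrS; exact: subgroupD.
Qed.

Lemma subgroupMz {X : zmodType} {G : set X} : is_subgroup G ->
  forall x k, G x -> G (x *~ k).
Proof.
move=> gG x [] n Gx; first exact: subgroupMn.
by rewrite NegzE mulrNz; apply: subgroupN => //; exact: subgroupMn.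
Qed.

Lemma subgroupP {X : zmodType} {G : set X} :
  G 0 -> (forall x y, G x -> G y -> G (x - y)) -> is_subgroup G.
Proof.
by move=> G0 GB; split=> [|x y /set_mem Gx /set_mem Gy]; apply/mem_set; auto.
Qed.

Lemma subspace_subgroup {X : lmodType rat} {U : set X} :
  is_subspace U -> is_subgroup U.
Proof. exact: GRing.submod_closedB. Qed.

Lemma subspaceZ {X : lmodType rat} {U : set X} : is_subspace U ->
  forall a x, U x -> U (a *: x).
Proof.
move=> sU a x Ux; rewrite -[a *: x]addr0; apply/set_mem.
by case: (sU) => U0 UL; apply: UL => //; exact/mem_set.
Qed.

(** * Cosets and their numbering *)

Lemma coset_eqP {X : zmodType} {H : set X} : is_subgroup H -> forall x y,
  [set x + h | h in H] = [set y + h | h in H] <-> H (x - y).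
Proof.
move=> gH x y; split=> [E|Hxy].
  have : [set x + h | h in H] x by exists 0; [exact: subgroup0|rewrite addr0].
  by rewrite E => -[h Hh <-]; rewrite addrAC subrr add0r.
apply/seteqP; split=> z [h Hh <-].
  exists (x - y + h); first exact: subgroupD.
  by rewrite addrA [y + _]addrC subrK.
exists (h - (x - y)); first exact: subgroupB.
by rewrite opprB addrCA subrKC addrC.
Qed.

(** Composing the bijection on cosets with the passage from a point to its coset gives a numbering
    [kappa] of points, the form in which the index of [Lambda'] is used. *)
Lemma has_indexP {X : zmodType} {G H : set X} {N : nat} : is_subgroup H ->
  has_index G H N ->
  exists kappa : X -> nat,
    [/\ forall x, G x -> (kappa x < N)%N,
        forall x y, G x -> G y -> kappa x = kappa y <-> H (x - y) &
        forall k, (k < N)%N -> exists2 x, G x & kappa x = k].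
Proof.
move=> gH /card_set_bijP [f [ffun finj fsurj]].
have Gcoset x : G x -> cosets G H [set x + h | h in H] by exists x.
exists (fun x => f [set x + h | h in H]); split.
- by move=> x /Gcoset /ffun.
- move=> x y Gx Gy; rewrite -(coset_eqP gH); split=> [|-> //].
  by apply: finj; apply/mem_set; exact: Gcoset.
- by move=> k /fsurj [_ [x Gx <-] <-]; exists x.
Qed.

(** * Adjoining one element to a subgroup *)

Definition adjoin {X : zmodType} (G : set X) (t : X) : set X :=
  [set x | exists k : int, G (x - t *~ k)].

Lemma adjoin_subgroup {X : zmodType} {G : set X} (t : X) :
  is_subgroup G -> is_subgroup (adjoin G t).
Proof.
move=> gG; apply: subgroupP => [|x y [k Gk] [l Gl]].
  by exists 0; rewrite mulr0z subr0; exact: subgroup0.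
by exists (k - l); rewrite mulrzBr subrACA; exact: subgroupB.
Qed.

Lemma sub_adjoin {X : zmodType} (G : set X) (t : X) : G `<=` adjoin G t.
Proof. by move=> x Gx; exists 0; rewrite mulr0z subr0. Qed.

(** Divide the coefficient of [t] by [N]: the quotient contributes a multiple of [t *+ N], which
    lies in [G], and the remainder is left. *)
Lemma adjoin_reduce {X : zmodType} {G : set X} {t : X} {N : nat} :
  is_subgroup G -> (0 < N)%N -> G (t *+ N) ->
  forall x, adjoin G t x -> exists2 k, (k < N)%N & G (x - t *+ k).
Proof.
move=> gG N0 GtN x [k Gk].
have Nn0 : N%:Z != 0 by rewrite -lt0n.
exists `|k %% N|%Z%N.
  by rewrite -ltz_nat gez0_abs ?modz_ge0// ltz_pmod.
rewrite pmulrn gez0_abs ?modz_ge0//.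
have -> : t *~ (k %% N)%Z = t *~ k - t *+ N *~ (k %/ N)%Z.
  apply/eqP; rewrite eq_sym subr_eq pmulrn -mulrzA -mulrzDr.
  by rewrite addrC [N%:Z * _]mulrC -divz_eq.
rewrite opprB addrCA addrC.
by apply: subgroupD => //; exact: subgroupMz.
Qed.

Lemma multiples_inj {X : zmodType} {G : set X} {t : X} {N : nat} :
  is_subgroup G -> (forall k, (k < N)%N -> G (t *+ k) -> k = 0%N) ->
  forall k l, (k < N)%N -> (l < N)%N -> G (t *+ k - t *+ l) -> k = l.
Proof.
move=> gG tmin k l.
wlog lk : k l / (l <= k)%N => [hw kN lN Gkl|kN lN].
  case/orP: (leq_total l k) => ?; first exact: hw.
  by symmetry; apply: hw => //; rewrite -opprB; exact: subgroupN.
rewrite -mulrnBr// => /tmin kl0.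
apply/eqP; rewrite eqn_leq lk andbT -subn_eq0; apply/eqP/kl0.
by rewrite (leq_ltn_trans (leq_subr _ _)).
Qed.

(** The hypotheses say that [t] has order exactly [N] modulo [G], so its multiples by k < N form a
    transversal. *)
Lemma adjoin_index {X : zmodType} {G : set X} {t : X} {N : nat} :
  is_subgroup G -> (0 < N)%N -> G (t *+ N) ->
  (forall k, (k < N)%N -> G (t *+ k) -> k = 0%N) ->
  has_index (adjoin G t) G N.
Proof.
move=> gG N0 GtN tmin; rewrite /has_index card_eq_sym; apply/card_set_bijP.
exists (fun k => [set t *+ k + h | h in G]); split.
- move=> k _; exists (t *+ k) => //.
  by exists k; rewrite -pmulrn subrr; exact: subgroup0.
- move=> k l /set_mem kN /set_mem lN /(coset_eqP gG).
  exact: (multiples_inj gG tmin).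
- move=> _ [x /(adjoin_reduce gG N0 GtN) [k kN Gk] <-].
  by exists k => //; apply/(coset_eqP gG); rewrite -opprB; exact: subgroupN.
Qed.

(** * Divisibility in finitely generated groups *)

(** The consequence of finite generation that yields primitive elements; it fails for the group of
    rationals. It passes to subsets and survives adjoining an element to a subgroup of a rational
    vector space, which allows induction on generators. *)
Definition finite_divisibility {X : zmodType} (G : set X) :=
  forall x, x <> 0 ->
    exists B : nat, forall n y, G y -> y *+ n = x -> (n <= B)%N.

Lemma mulrz_neq0 {X : lmodType rat} (x : X) (k : int) :
  x <> 0 -> k <> 0 -> x *~ k <> 0.
Proof.
move=> /eqP x0 /eqP k0; apply/eqP.
by rewrite -scaler_int scaler_eq0 intr_eq0 negb_or k0.
Qed.

Lemma adjoin_finite_divisibility {X : lmodType rat} {G : set X} (s : X) :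
  is_subgroup G -> finite_divisibility G -> finite_divisibility (adjoin G s).
Proof.
move=> gG dG x x0.
(* If s * M is in G, a divisor in adjoin G s of x gives one in G of x * M;
   otherwise the coefficient of s is unique and divisible by the divisor. *)
have [[M [M0 GsM]]|sfree] := pselect (exists M : int, M <> 0 /\ G (s *~ M)).
  have [B HB] := dG _ (mulrz_neq0 x M x0 M0).
  exists B => n y [k Gk] yn; apply: (HB n (y *~ M)); last first.
    by rewrite -yn !pmulrn -!mulrzA mulrC.
  rewrite -[y](subrK (s *~ k)) mulrzDl.
  apply: (subgroupD gG); first exact: subgroupMz.
  by rewrite -mulrzA mulrC mulrzA; exact: subgroupMz.
have [[j Gj]|xH] := pselect (adjoin G s x); last first.
  exists 0%N => n y Hy yn; case: xH; rewrite -yn.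
  by apply: subgroupMn => //; exact: adjoin_subgroup.
have coef n y k : G (y - s *~ k) -> y *+ n = x -> j = k * n.
  move=> Gk yn; apply/eqP; rewrite -subr_eq0; apply/eqP.
  apply: contrapT => jk; apply: sfree; exists (j - k * n%:Z); split=> //.
  have -> : s *~ (j - k * n%:Z) = (y - s *~ k) *+ n - (x - s *~ j).
    by rewrite mulrnBl yn subrACA subrr sub0r opprB mulrzBr mulrzA -pmulrn.
  by apply: subgroupB => //; exact: subgroupMn.
(* [B] bounds the divisors that lie in [G] (k = 0); [|j|] bounds the others, since j = k n with k
   nonzero. *)
have [B HB] := dG _ x0; exists (maxn B `|j|) => n y [k Gk] yn.
have jE := coef _ _ _ Gk yn.
rewrite leq_max; have [k0|k0] := eqVneq k 0.
  by apply/orP; left; apply: HB yn; rewrite k0 mulr0z subr0 in Gk.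
by apply/orP; right; rewrite jE abszM absz_nat leq_pmull// absz_gt0.
Qed.

(** Induction on [m]: the span of m + 1 generators is contained in the span of the first m with
    [f m] adjoined. *)
Lemma int_span_finite_divisibility {X : lmodType rat} (f : nat -> X) (m : nat) :
  finite_divisibility [set x | exists a : nat -> int, x = \sum_(i < m) f i *~ a i].
Proof.
elim: m => [|m IHm].
  move=> x x0; exists 0%N => n y [a]; rewrite big_ord0 => ->.
  by rewrite mul0rn => /esym.
have gS : is_subgroup
    [set x | exists a : nat -> int, x = \sum_(i < m) f i *~ a i].
  apply: subgroupP => [|_ _ [a ->] [b ->]].
    by exists (fun=> 0); rewrite big1.
  exists (fun i => a i - b i); rewrite -sumrB.
  by apply: eq_bigr => i _; rewrite mulrzBr.
move=> x /(adjoin_finite_divisibility (f m) gS IHm) [B HB].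
exists B => n y [a yE]; apply: HB; exists (a m), a.
by rewrite yE big_ord_recr addrK.
Qed.

(* t is a primitive element of G divided by N. *)
Lemma finite_divisibility_root {X : lmodType rat} {G : set X} {N : nat} :
  is_subgroup G -> finite_divisibility G -> (0 < N)%N ->
  (exists2 x, G x & x <> 0) ->
  exists t, G (t *+ N) /\ forall k, (k < N)%N -> G (t *+ k) -> k = 0%N.
Proof.
move=> gG dG N0 [x Gx x0]; have [B HB] := dG _ x0.
pose P n := `[< exists2 y, G y & y *+ n = x >].
have exP : exists n, P n by exists 1%N; apply/asboolP; exists x.
have bP n : P n -> (n <= B)%N by move=> /asboolP [y]; exact: HB.
(* [e] is [x] divided by the largest possible [n], hence primitive: if m divides [e] in [G], then m
   n divides [x]. *)
case: (ex_maxnP exP bP) => n /asboolP [e Ge en] nmax.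
have n0 : (0 < n)%N by case: n en {nmax} => // en; case: x0; rewrite -en.
have eprim m y : G y -> y *+ m = e -> (m <= 1)%N.
  move=> Gy ym; rewrite -(leq_pmul2r n0) mul1n.
  by apply: nmax; apply/asboolP; exists y; rewrite // mulrnA ym.
exists (N%:R^-1 *: e); set t := _ *: _.
have tN : t *+ N = e.
  by rewrite -scaler_nat scalerA divff ?scale1r// pnatr_eq0 -lt0n.
split=> [|k kN Gtk]; first by rewrite tN.
apply/eqP; rewrite -leqn0 leqNgt; apply/negP => k0.
(* By Bezout, t times d = gcd(k, N) lies in [G]. As [e] is N / d times this element, primitivity
   forces N / d <= 1, against d <= k < N. *)
have [u v uv _] := egcdnP N k0.
have Gd : G (t *+ gcdn k N).
  have -> : t *+ gcdn k N = t *+ k *+ u - e *+ v.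
    by rewrite -tN -!mulrnA mulnC uv mulrnDr [(N * v)%N]mulnC addrAC subrr add0r.
  by apply: subgroupB => //; exact: subgroupMn.
have := eprim (N %/ gcdn k N)%N _ Gd.
rewrite -mulrnA mulnC divnK ?dvdn_gcdr// => /(_ tN).
rewrite leqNgt => /negP; apply.
rewrite ltn_divRL ?dvdn_gcdr// mul1n.
by rewrite (leq_ltn_trans _ kN)// dvdn_leq// dvdn_gcdl.
Qed.

(** * Projections along complementary subspaces *)

(** [rho x - a] lies in both [U] and [V]. Values of the projections are computed through this
    uniqueness. *)
Lemma projectionP {X : lmodType rat} {U V : set X} {rho : X -> X} :
  is_subspace U -> is_subspace V -> U `&` V = [set 0] ->
  is_projection U V rho -> forall x a, U a -> V (x - a) -> rho x = a.
Proof.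
move=> /subspace_subgroup gU /subspace_subgroup gV UV rhoE x a Ua Va.
have [Ur Vr] := rhoE x.
apply/eqP; rewrite -subr_eq0; apply/eqP.
have : (U `&` V) (rho x - a).
  split; first exact: subgroupB.
  have -> : rho x - a = x - a - (x - rho x) by rewrite subrACA subrr sub0r opprB.
  exact: subgroupB.
by rewrite UV.
Qed.

Lemma projectionB {X : lmodType rat} {U V : set X} {rho : X -> X} :
  is_subspace U -> is_subspace V -> U `&` V = [set 0] ->
  is_projection U V rho -> {morph rho : x y / x - y}.
Proof.
move=> sU sV UV rhoE x y; apply: (projectionP sU sV UV rhoE).
  by apply: (subgroupB (subspace_subgroup sU)); [case: (rhoE x)|case: (rhoE y)].
rewrite subrACA.
by apply: (subgroupB (subspace_subgroup sV)); [case: (rhoE x)|case: (rhoE y)].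
Qed.

(** * Bounds for the metric *)

(** On the unit ball about x the distance to [a] is at most [1 + mdist x a]; compactness makes one
    natural number serve all of [K]. *)
Lemma compact_mdist_bounded {R : realType} {X : metricType R} (a : X)
  (K : set X) : compact K -> exists C : R, forall x, K x -> mdist x a <= C.
Proof.
move=> /compact_near_coveringP cK.
have [|n _ Hn] := cK nat \oo (fun n x => mdist x a <= n%:R) _; last first.
  by exists n%:R => x Kx; apply: (Hn n) => //=.
move=> x _; near=> x' n => /=.
apply: (@le_trans _ _ (1 + mdist x a)).
  apply: le_trans (metric_triangle _ x _) _; rewrite lerD2r metric_sym ltW//.
  have : ball x 1 x' by near: x'; exact: nbhsx_ballx.
  by rewrite ballEmdist.
by near: n; exact: nbhs_infty_ger.
Unshelve. all: by end_near. Qed.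

Lemma mdistB0 {R : realType} {X : metricQmodType R} :
  translation_invariant X -> forall x y : X, mdist (x - y) 0 = mdist x y.
Proof. by move=> dX x y; rewrite -(dX (x - y) 0 y) subrK add0r. Qed.

Lemma mdistB_le {R : realType} {X : metricQmodType R} :
  translation_invariant X ->
  forall x y : X, mdist (x - y) 0 <= mdist x 0 + mdist y 0.
Proof.
by move=> dX x y; rewrite mdistB0// (le_trans (metric_triangle _ 0 _))//
  (metric_sym 0).
Qed.

(* [nondeg] is not in the informal statement. If Lambda_c = {0}, the conclusion
   asks for a subgroup of order N of a torsion-free group, which exists only
   for N = 1, while the other hypotheses allow N = 2. *)
Theorem theorem2p1
  (R : realType) (X : metricQmodType R)
  (d_inv : translation_invariant X)
  (Vp Vi : set X)
  (Vp_sub : is_subspace Vp) (Vi_sub : is_subspace Vi)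
  (VpVi : complementary Vp Vi)
  (rho_p rho_i : X -> X)
  (rho_pE : is_projection Vp Vi rho_p) (rho_iE : is_projection Vi Vp rho_i)
  (Gamma : set X)
  (Gamma_gr : is_subgroup Gamma) (Gamma_fg : finitely_generated Gamma)
  (W : set X) (W_sub : W `<=` Vi) (W_cpt : compact W)
  (Z : set X) (Z_sub : is_subspace Z) (VpZ : complementary Vp Z)
  (phi_p : X -> X) (phi_pE : is_projection Vp Z phi_p)
  (Lambda Lambda_c : set X)
  (Lambda_gr : is_subgroup Lambda) (Lambda_c_gr : is_subgroup Lambda_c)
  (GammaE : Gamma = minkowski_sum Lambda Lambda_c)
  (Lambda_dir : Lambda `&` Lambda_c = [set 0])
  (ZGamma : Z `&` Gamma = Lambda)
  (Lambda' : set X)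
  (Lambda'_gr : is_subgroup Lambda') (Lambda'_sub : Lambda' `<=` Lambda)
  (N : nat) (Lambda_index : has_index Lambda Lambda' N)
  (F : set X) (F_cpt : compact F) (F_dom : fundamental_domain Z Lambda' F)
  (WE : W = rho_i @` F)
  (nondeg : Lambda_c = [set 0] -> N = 1%N) :
  let Ytilde := rho_i @^-1` W `&` Gamma in
  exists Lambda_c' : set X,
    [/\ is_subgroup Lambda_c', Lambda_c' `<=` Vp,
        phi_p @` Lambda_c `<=` Lambda_c',
        has_index Lambda_c' (phi_p @` Lambda_c) N &
        exists g : X -> X, set_bij Ytilde Lambda_c' g /\
          exists C : R, forall y, Ytilde y -> mdist (g y) (rho_p y) <= C].

Proof.
move=> Ytilde; set L := phi_p @` Lambda_c.
have gVp := subspace_subgroup Vp_sub; have gVi := subspace_subgroup Vi_sub.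
have gZ := subspace_subgroup Z_sub.
have [VpVi0 _] := VpVi; have [VpZ0 _] := VpZ.
have ViVp0 : Vi `&` Vp = [set 0] by rewrite setIC.
have phiP := projectionP Vp_sub Z_sub VpZ0 phi_pE.
have phiB := projectionB Vp_sub Z_sub VpZ0 phi_pE.
have phiZ z : Z z -> phi_p z = 0.
  by move=> Zz; apply: phiP; rewrite ?subr0//; exact: subgroup0.
have LambdaZ : Lambda `<=` Z by rewrite -ZGamma => z [].
have phiLambda x y : Lambda (x - y) -> phi_p x = phi_p y.
  by move=> /LambdaZ/phiZ; rewrite phiB => /eqP; rewrite subr_eq0 => /eqP.
have gL : is_subgroup L.
  apply: subgroupP => [|_ _ [x cx <-] [y cy <-]].
    by exists 0; [exact: subgroup0|apply: phiZ; exact: subgroup0].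
  by exists (x - y) => //; exact: subgroupB.
have LVp : L `<=` Vp by move=> _ [x _ <-]; case: (phi_pE x).
(* [lam] selects the [Lambda]-component of a point of [Gamma]; its value 0 elsewhere is a
   default. *)
have /choice [lam lamP] x : exists l, Gamma x -> Lambda l /\ Lambda_c (x - l).
  have [Gx|nGx] := pselect (Gamma x); last by exists 0.
  move: Gx; rewrite {1}GammaE => -[l Ll [c Lc <-]].
  by exists l; rewrite addrAC subrr add0r.
have lamD l c : Lambda l -> Lambda_c c -> Gamma (l + c) /\ lam (l + c) = l.
  move=> Ll Lc; have Glc : Gamma (l + c) by rewrite GammaE; exists l => //; exists c.
  split=> //; have [Ll' Lc'] := lamP _ Glc.
  apply/eqP; rewrite -subr_eq0; apply/eqP.
  have : (Lambda `&` Lambda_c) (lam (l + c) - l).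
    split; first exact: subgroupB.
    have -> : lam (l + c) - l = c - (l + c - lam (l + c)).
      by rewrite [l + c]addrC -addrA opprD addrA subrr sub0r opprB.
    exact: subgroupB.
  by rewrite Lambda_dir.
(* The kernel of [phi_p] on [Gamma] is [Z] intersected with [Gamma], that is [Lambda], which meets
   [Lambda_c] only in 0. *)
have phi_inj c : Lambda_c c -> phi_p c = 0 -> c = 0.
  move=> Lc c0; suff : (Lambda `&` Lambda_c) c by rewrite Lambda_dir.
  split=> //; rewrite -ZGamma; split.
    by have [_] := phi_pE c; rewrite c0 subr0.
  by rewrite GammaE; exists 0; [exact: subgroup0|exists c; rewrite ?add0r].
(* [L] lies in the integer span of the images of the generators of [Gamma], so the bounds for that
   span apply to it. *)
have dL : finite_divisibility L.
  have [m [s sE]] := Gamma_fg.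
  move=> x /(int_span_finite_divisibility (fun i => phi_p s`_i) m) [B HB].
  exists B => n _ [c Lc <-]; apply: HB.
  have : Gamma c by rewrite GammaE; exists 0; [exact: subgroup0|exists c; rewrite ?add0r].
  rewrite sE => -[a ->].
  pose aphi := GRing.isZmodMorphism.Build _ _ _ phiB.
  pose phiM : {additive X -> X} := HB.pack phi_p aphi.
  (* The coefficients, indexed by the ordinals below [m], are extended by 0 to all of [nat]. *)
  exists (fun i => if insub i is Some j then a j else 0).
  rewrite -[phi_p _]/(phiM _) raddf_sum; apply: eq_bigr => i _.
  by rewrite valK raddfMz.
have [kappa [kappaN kappaE kappaS]] := has_indexP Lambda'_gr Lambda_index.
have N0 : (0 < N)%N.
  by apply: leq_ltn_trans (kappaN 0 _) => //; exact: subgroup0.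
have [t [LtN tmin]] : exists t, L (t *+ N) /\
    forall k, (k < N)%N -> L (t *+ k) -> k = 0%N.
  have [|L0] := pselect (exists2 x, L x & x <> 0).
    exact: finite_divisibility_root.
  (* If [L] is trivial, so is [Lambda_c] by [phi_inj]; then [nondeg] gives N = 1, for which t = 0
     works. *)
  exists 0; split=> [|k]; first by rewrite mul0rn; exact: subgroup0.
  rewrite nondeg; first by case: k.
  apply/seteqP; split=> [c Lc|_ ->]; last exact: subgroup0.
  apply: phi_inj => //; apply: contrapT => c0; apply: L0.
  by exists (phi_p c) => //; exists c.
have Vpt : Vp t.
  have -> : t = N%:R^-1 *: (t *+ N).
    by rewrite -scaler_nat scalerA mulVf ?scale1r// pnatr_eq0 -lt0n.
  by apply: subspaceZ => //; exact: LVp.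
have rhoiVp x : Vp x -> rho_i x = 0.
  move=> Vx; apply: (projectionP Vi_sub Vp_sub ViVp0 rho_iE).
    exact: subgroup0.
  by rewrite subr0.
have rhoiB := projectionB Vi_sub Vp_sub ViVp0 rho_iE.
(* If [rho_i y = rho_i z] with z in [F], then y - z is in [Vp] and z in [Z], so z is the
   [Z]-component of y. *)
have YtildeP y : Ytilde y <-> Gamma y /\ F (y - phi_p y).
  split=> [[]|[Gy Fy]].
    rewrite /preimage/= WE => -[z Fz zy] Gy; split=> //.
    suff -> : phi_p y = y - z by rewrite subKr.
    apply: phiP; last by rewrite subKr; case: F_dom => FZ _; exact: FZ.
    have [_] := rho_iE (y - z).
    by rewrite rhoiB zy subrr subr0.
  split=> //; rewrite /preimage/= WE; exists (y - phi_p y) => //.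
  by rewrite rhoiB (rhoiVp (phi_p y)) ?subr0//; case: (phi_pE y).
have F_inj a b : F a -> F b -> Lambda' (a - b) -> a = b.
  move=> Fa Fb /(coset_eqP Lambda'_gr) ab; have [FZ Fdom] := F_dom.
  have in_coset z : [set z + h | h in Lambda'] z.
    by exists 0; [exact: subgroup0|rewrite addr0].
  have [|z [_ zuniq]] := Fdom [set a + h | h in Lambda'].
    by exists a => //; exact: FZ.
  rewrite -(zuniq a); last by split.
  by apply: zuniq; split=> //; rewrite ab.
have F_surj z : Z z -> exists2 l, Lambda' l & F (z + l).
  move=> Zz; have [_ Fdom] := F_dom.
  have [|w [[Fw [l Ll zlw]] _]] := Fdom [set z + h | h in Lambda'].
    by exists z.
  by exists l; rewrite // zlw.
exists (adjoin L t); split.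
- exact: adjoin_subgroup.
- move=> x [k /LVp Vk]; rewrite -(subrK (t *~ k) x).
  by apply: subgroupD => //; exact: subgroupMz.
- exact: sub_adjoin.
- exact: adjoin_index.
(* Since [phi_p] vanishes on [Lambda], [phi_p y] is the image of the [Lambda_c]-component of y. *)
exists (fun y => phi_p y + t *+ kappa (lam y)); split.
  have phi_c y : Gamma y -> L (phi_p y).
    move=> /lamP [Ll Lc]; exists (y - lam y) => //; apply: phiLambda.
    by rewrite addrAC subrr add0r; exact: subgroupN.
  split.
  - move=> y /YtildeP [/phi_c Ly _]; exists (kappa (lam y)).
    by rewrite -pmulrn addrK.
  (* Modulo [L] equal images have equal [kappa], so the values of [phi_p] agree, then the
     [Lambda_c]-components. Hence x - y is in [Lambda'], and [F_inj] applies to the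
     [Z]-components. *)
  - move=> x y /set_mem/YtildeP [Gx Fx] /set_mem/YtildeP [Gy Fy] E.
    have [Lx cx] := lamP _ Gx; have [Ly cy] := lamP _ Gy.
    have phixy : phi_p x - phi_p y = t *+ kappa (lam y) - t *+ kappa (lam x).
      by apply/eqP; rewrite subr_eq addrAC [t *+ _ + _]addrC -E addrK.
    have kxy : kappa (lam x) = kappa (lam y).
      symmetry; apply: (multiples_inj gL tmin); rewrite ?kappaN// -phixy.
      by apply: subgroupB => //; exact: phi_c.
    move: phixy; rewrite kxy subrr => /eqP; rewrite subr_eq0 => /eqP phixy.
    have xyc : x - lam x = y - lam y.
      apply/eqP; rewrite -subr_eq0; apply/eqP; apply: phi_inj.
        exact: subgroupB.
      by rewrite !phiB phixy !(phiZ (lam _)) ?subrr//; exact: LambdaZ.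
    have xyl : x - y = lam x - lam y.
      by apply/eqP; rewrite -subr_eq0 subrACA xyc subrr.
    have : x - phi_p x = y - phi_p y.
      by apply: F_inj => //; rewrite subrACA phixy subrr subr0 xyl; apply/kappaE.
    by rewrite phixy => /addIr.
  - move=> x /(adjoin_reduce gL N0 LtN) [k kN [c Lc cx]].
    have [l Ll lk] := kappaS _ kN.
    (* Correcting [l] by an element of [Lambda'] moves the [Z]-component of l + c into [F] without
       changing the number k. *)
    have [l' Ll' Fl'] : exists2 l', Lambda' l' & F (l + (c - phi_p c) + l').
      apply: F_surj; apply: (subgroupD gZ); first exact: LambdaZ.
      by case: (phi_pE c).
    have Lll' : Lambda (l + l') by apply: subgroupD => //; exact: Lambda'_sub.
    have [Gy lamy] := lamD _ _ Lll' Lc.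
    have phiy : phi_p (l + l' + c) = phi_p c by apply: phiLambda; rewrite addrK.
    exists (l + l' + c).
      apply/YtildeP; split=> //; rewrite phiy.
      by rewrite -addrA addrAC.
    have -> : kappa (lam (l + l' + c)) = k.
      by rewrite lamy -lk; apply/kappaE => //; rewrite addrAC subrr add0r.
    by rewrite phiy cx subrK.
have [CF HF] := compact_mdist_bounded 0 _ F_cpt.
have [CW HW] := compact_mdist_bounded 0 _ W_cpt.
(* The sum dominates each of its terms, hence the contribution of [t *+ kappa (lam y)]; [CF] bounds
   the [Z]-component of y and [CW] bounds [rho_i y]. *)
exists (\sum_(k < N) mdist (t *+ k) 0 + (CF + CW)) => y [Wy Gy].
have /YtildeP [_ Fy] : Ytilde y by [].
have -> : rho_p y = y - rho_i y.
  apply: (projectionP Vp_sub Vi_sub VpVi0 rho_pE); first by case: (rho_iE y).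
  by rewrite subKr; case: (rho_iE y).
rewrite -mdistB0//.
have -> : phi_p y + t *+ kappa (lam y) - (y - rho_i y) =
    t *+ kappa (lam y) - (y - phi_p y - rho_i y).
  by rewrite [phi_p y + _]addrC -addrA; congr (_ + _); rewrite !opprB addrCA addrC.
apply: le_trans (mdistB_le d_inv _ _) _; apply: lerD; last first.
  apply: le_trans (mdistB_le d_inv _ _) _.
  by apply: lerD; [exact: HF|exact: HW].
have [Ly _] := lamP _ Gy.
rewrite (bigD1 (Ordinal (kappaN _ Ly)))//= lerDl.
by apply: sumr_ge0 => i _; exact: mdist_ge0.
Qed.
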